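(* The double sequences $\mathcal{A}^{1,1}$ and $\mathcal{A}^{\mathrm{id},\mathrm{id}}$ (obtained for $g=h=1$ and for $g=h=\mathrm{id}$) are both horizontally log-concave and vertically log-concave.
   Context: Here $\mathbb{N}=\{1,2,3,\dots\}$, and $1$ and $\mathrm{id}$ denote the arithmetic functions $1(n)=1$, $\mathrm{id}(n)=n$. For positive real-valued arithmetic functions $g,h$ on $\mathbb{N}$ with $g(1)=h(1)=1$, the polynomials $P_n^{g,h}(x)$ are defined by $P_0^{g,h}(x)=1$ and $P_n^{g,h}(x)=\frac{x}{h(n)}\sum_{k=1}^{n} g(k)\,P_{n-k}^{g,h}(x)$ for $n\ge 1$. For $n\ge1$ write $P_n^{g,h}(x)=\sum_{m=1}^n A_{n,m}^{g,h}x^m$. The double sequence $\mathcal{A}^{g,h}=\{a_{n,m}^{g,h}\}$ is defined by $a_{n,m}^{g,h}=A_{n,m}^{g,h}$ for $1\le m\le n$ and $a_{n,m}^{g,h}=0$ otherwise. A sequence $\{a_n\}_{n\ge0}$ of non-negative reals is log-concave if $a_n^2\ge a_{n-1}a_{n+1}$ for all $n\ge1$. A double sequence $\{a_{n,m}\}$ is horizontally log-concave if for every $n_0\in\mathbb{N}$ the sequence $\{a_{n_0,m}\}_m$ is log-concave, and vertically log-concave if for every $m_0\in\mathbb{N}$ the sequence $\{a_{n,m_0}\}_n$ is log-concave. *)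

(* Defs.v *)
From mathcomp Require Import all_boot all_order all_algebra.
From mathcomp Require Import reals.
Set Implicit Arguments.
Unset Strict Implicit.
Unset Printing Implicit Defensive.
Import Order.TTheory GRing.Theory Num.Theory.
Local Open Scope ring_scope.

(* The values at 0 of arithmetic functions are never used below. *)
Definition arith_one (R : realType) : nat -> R := fun _ => 1.
Definition arith_id (R : realType) : nat -> R := fun n => n%:R.

(* Course-of-values recursion: Pseq g h n = [:: P_0; ...; P_n]. *)
Fixpoint Pseq (R : realType) (g h : nat -> R) (n : nat) : seq {poly R} :=
  if n is n'.+1 then
    let s := Pseq g h n' in
    rcons s ((h n)^-1 *: ('X * \sum_(1 <= k < n.+1) g k *: s`_(n - k)))
  else [:: 1].

Definition P (R : realType) (g h : nat -> R) (n : nat) : {poly R} :=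
  (Pseq g h n)`_n.

Lemma size_Pseq (R : realType) (g h : nat -> R) (n : nat) :
  size (Pseq g h n) = n.+1.
Proof. by elim: n => //= n IHn; rewrite size_rcons IHn. Qed.

Lemma nth_Pseq (R : realType) (g h : nat -> R) (n k : nat) :
  (k <= n)%N -> (Pseq g h n)`_k = P g h k.
Proof.
elim: n => [|n IHn]; first by rewrite leqn0 => /eqP->.
rewrite leq_eqVlt => /orP[/eqP-> //|]; rewrite ltnS => le_kn.
by rewrite /= nth_rcons size_Pseq ltnS le_kn IHn.
Qed.

Lemma P_zero (R : realType) (g h : nat -> R) : P g h 0 = 1.
Proof. by []. Qed.

Lemma P_succ (R : realType) (g h : nat -> R) (n : nat) : (0 < n)%N ->
  P g h n = (h n)^-1 *: ('X * \sum_(1 <= k < n.+1) g k *: P g h (n - k)).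
Proof.
case: n => // n _; rewrite {1}/P /= nth_rcons size_Pseq ltnn eqxx.
congr (_ *: ('X * _)); rewrite !big_nat; apply: eq_bigr => -[//|k] _.
by rewrite nth_Pseq // subSS leq_subr.
Qed.

(* The double sequence is indexed by nat * nat; entries with n = 0 or m = 0
   fall under the "otherwise" case. *)
Definition dseq (R : realType) (g h : nat -> R) (n m : nat) : R :=
  if (1 <= m <= n)%N then (P g h n)`_m else 0.

Definition log_concave (R : realType) (a : nat -> R) : Prop :=
  (forall n : nat, 0 <= a n) /\
  (forall n : nat, (1 <= n)%N -> a n.-1 * a n.+1 <= a n ^+ 2).

Definition horizontally_log_concave (R : realType) (a : nat -> nat -> R) : Prop :=
  forall n0 : nat, (1 <= n0)%N -> log_concave (fun m => a n0 m).

Definition vertically_log_concave (R : realType) (a : nat -> nat -> R) : Prop :=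
  forall m0 : nat, (1 <= m0)%N -> log_concave (fun n => a n m0).

(* Main.v *)
Require Import Defs.
From mathcomp Require Import all_boot all_order all_algebra.
From mathcomp Require Import reals.
From mathcomp Require Import zify.

(** Both double sequences have closed forms.  The coefficient of [x^m] in
    [P_n] is obtained by [m] successive convolutions with [g], each divided by
    [h].  For [g = h = 1] a convolution is a partial sum, so the hockey-stick
    identity turns ['C(n, m)] into ['C(n, m.+1)] and the coefficients are
    [A_{n+1,m+1} = 'C(n, m)].  For [g = h = id] the convolution is a double
    partial sum, which turns ['C(n, m)] into ['C(n.+1, m.+2)]; dividing by
    [n.+1] and absorbing, one gets [A_{n+1,m+1} = 'C(n, m) / (m.+1)`!]
    ([coefP_one] and [coefP_id]).

    It remains to see that binomial coefficients are log-concave in each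
    argument and that [1 / (m.+1)`!] is log-concave in [m], since log-concavity
    is stable under products ([log_concaveM]) and under prepending a zero
    ([log_concave_shift]).  In the lower argument, log-concavity of ['C(n, m)]
    says that the ratios [(n - m) / m.+1] decrease; log-concavity in the upper
    argument is the same inequality rewritten by Pascal's rule
    ([bin_log_concave_up]). *)

Set Implicit Arguments.
Unset Strict Implicit.
Unset Printing Implicit Defensive.
Import Order.TTheory GRing.Theory Num.Theory.
Local Open Scope ring_scope.

Lemma sum_bin (n m : nat) : (\sum_(j < n) 'C(j, m) = 'C(n, m.+1))%N.
Proof.
elim: n => [|n IHn]; first by rewrite big_ord0.
by rewrite big_ord_recr /= IHn binS.
Qed.

(** Raising [n] by one adds a full partial sum, so the weights [n - j] encode
    two successive summations. *)
Lemma sum_weighted_bin (n m : nat) :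
  (\sum_(j < n) (n - j) * 'C(j, m) = 'C(n.+1, m.+2))%N.
Proof.
elim: n => [|n IHn]; first by rewrite big_ord0 bin_small.
rewrite binS -IHn -sum_bin !big_ord_recr /= subSnn mul1n addnA; congr addn.
by rewrite -big_split; apply: eq_bigr => j _ /=; rewrite subSn ?mulSnr // ltnW.
Qed.

Lemma bin_log_concave_down (n m : nat) :
  ('C(n, m) * 'C(n, m.+2) <= 'C(n, m.+1) ^ 2)%N.
Proof.
have e1 := mul_bin_left n m; have e2 := mul_bin_left n m.+1.
rewrite -(leq_pmul2l (ltn0Sn m.+1)) mulnCA e2 mulnCA.
apply: (@leq_trans (m.+1 * 'C(n, m.+1) ^ 2)); last by rewrite leq_mul2r leqnSn orbT.
have -> : (m.+1 * 'C(n, m.+1) ^ 2 = (n - m) * ('C(n, m) * 'C(n, m.+1)))%N.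
  by rewrite [RHS]mulnA -e1 -mulnA.
by rewrite leq_mul2r leq_sub2l ?orbT.
Qed.

(** With [a, b, c] the entries of row [n] at [m.+2, m.+1, m], Pascal's rule
    gives [(a + b)^2 - a (a + 2 b + c) = b^2 - a c]. *)
Lemma bin_log_concave_up (n m : nat) :
  ('C(n, m) * 'C(n.+2, m) <= 'C(n.+1, m) ^ 2)%N.
Proof.
case: m => [|[|m]]; first by rewrite !bin0.
  by rewrite !bin1; nia.
have := bin_log_concave_down n m; rewrite !binS; nia.
Qed.

Lemma eq_log_concave (R : realType) (a b : nat -> R) :
  a =1 b -> log_concave b -> log_concave a.
Proof.
by move=> eab [b0 bl]; split=> n; rewrite !eab //; apply: bl.
Qed.

Lemma log_concave_cst (R : realType) (c : R) :
  0 <= c -> log_concave (fun _ : nat => c).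
Proof. by move=> c0; split=> // n _; rewrite expr2. Qed.

Lemma log_concaveM (R : realType) (a b : nat -> R) :
  log_concave a -> log_concave b -> log_concave (fun n => a n * b n).
Proof.
move=> [a0 al] [b0 bl]; split=> n; first exact: mulr_ge0.
move=> n0; rewrite mulrACA exprMn.
by apply: ler_pM; rewrite ?mulr_ge0 ?al ?bl.
Qed.

Definition shift (R : realType) (a : nat -> R) (n : nat) : R :=
  if n is k.+1 then a k else 0.

Lemma log_concave_shift (R : realType) (a : nat -> R) :
  log_concave a -> log_concave (shift a).
Proof.
move=> [a0 al]; split=> [[|n]|[|[|n]]] //=; first by rewrite mul0r sqr_ge0.
by move=> _; apply: (al n.+1).
Qed.

Lemma log_concave_nat (R : realType) (a : nat -> nat) :
  (forall n, a n * a n.+2 <= a n.+1 ^ 2)%N -> log_concave (fun n => (a n)%:R : R).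
Proof.
move=> al; split=> [n|[|n] // _ /=]; first exact: ler0n.
by rewrite -natrM -natrX ler_nat.
Qed.

Lemma log_concave_inv_factS (R : realType) :
  log_concave (fun m => ((m.+1)`!)%:R^-1 : R).
Proof.
split=> [m|[|m] // _ /=]; first by rewrite invr_ge0 ler0n.
rewrite -invfM exprVn lef_pV2 ?posrE ?mulr_gt0 ?exprn_gt0 ?ltr0n ?fact_gt0 //.
rewrite -natrM -natrX ler_nat.
by rewrite !(factS m.+2, factS m.+1); nia.
Qed.

Lemma coefP_zero (R : realType) (g h : nat -> R) (n : nat) :
  (P g h n.+1)`_0 = 0.
Proof. by rewrite P_succ // coefZ coefXM mulr0. Qed.

Lemma coefP_succ (R : realType) (g h : nat -> R) (n m : nat) :
  (P g h n.+1)`_m.+1 =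
    (h n.+1)^-1 * \sum_(j < n.+1) g (n.+1 - j)%N * (P g h j)`_m.
Proof.
rewrite P_succ // coefZ coefXM /= coef_sum big_add1 /= big_mkord.
congr (_ * _); rewrite (reindex_inj rev_ord_inj); apply: eq_bigr => j _ /=.
have lejn : (j <= n)%N by rewrite -ltnS ltn_ord.
by rewrite coefZ subSS -subSn // subKn // leqW.
Qed.

(** Only [P_0] has a constant term. *)
Lemma coefP_one_term (R : realType) (g h : nat -> R) (n : nat) :
  (P g h n.+1)`_1 = g n.+1 / h n.+1.
Proof.
rewrite coefP_succ big_ord_recl /= subn0 P_zero coef1 mulr1 big1 ?addr0.
  by rewrite mulrC.
by move=> j _; rewrite coefP_zero mulr0.
Qed.

Lemma coefP_conv (R : realType) (g h : nat -> R) (n m : nat) :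
  (P g h n.+1)`_m.+2 =
    (h n.+1)^-1 * \sum_(j < n) g (n - j)%N * (P g h j.+1)`_m.+1.
Proof.
rewrite coefP_succ big_ord_recl P_zero coef1 mulr0 add0r.
by congr (_ * _); apply: eq_bigr => j _; rewrite lift0 subSS.
Qed.

Lemma coefP_one (R : realType) (n m : nat) :
  (P (arith_one R) (arith_one R) n.+1)`_m.+1 = 'C(n, m)%:R.
Proof.
elim: m n => [|m IHm] n; first by rewrite coefP_one_term bin0 divr1.
rewrite coefP_conv invr1 mul1r -sum_bin natr_sum.
by apply: eq_bigr => j _; rewrite IHm mul1r.
Qed.

Lemma coefP_id (R : realType) (n m : nat) :
  (P (arith_id R) (arith_id R) n.+1)`_m.+1 = 'C(n, m)%:R / ((m.+1)`!)%:R.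
Proof.
elim: m n => [|m IHm] n.
  by rewrite coefP_one_term bin0 divr1 divff // pnatr_eq0.
rewrite coefP_conv /arith_id.
under eq_bigr do rewrite IHm mulrA -natrM.
rewrite -mulr_suml -natr_sum sum_weighted_bin.
have n0 : n.+1%:R != 0 :> R by rewrite pnatr_eq0.
have m0 : m.+2%:R != 0 :> R by rewrite pnatr_eq0.
(* Absorption trades the division by [n.+1] for the next factor of the
   factorial. *)
have absorb : n.+1%:R * 'C(n, m.+1)%:R = m.+2%:R * 'C(n.+1, m.+2)%:R :> R.
  by rewrite -!natrM mul_bin_diag.
have -> : (m.+2)`!%:R = m.+2%:R * (m.+1)`!%:R :> R by rewrite -natrM -factS.
by apply: (mulfI n0); rewrite mulVKf // mulrA absorb -mulf_div divff // mul1r.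
Qed.

(** [dseq] cuts off [m > n]; a closed form by ['C(n, m)] vanishes there too, so
    it holds on the whole quadrant. *)
Lemma log_concave_dseq (R : realType) (g h : nat -> R) (w : nat -> R) :
    (forall n m, (P g h n.+1)`_m.+1 = 'C(n, m)%:R * w m) -> log_concave w ->
  horizontally_log_concave (dseq g h) /\ vertically_log_concave (dseq g h).
Proof.
move=> coefE lw.
have dseqE n m : dseq g h n.+1 m.+1 = 'C(n, m)%:R * w m.
  rewrite /dseq /= ltnS; case: leqP => [_|ltnm]; first exact: coefE.
  by rewrite bin_small // mul0r.
split=> [[|n] // _|[|m] // _].
  apply: (@eq_log_concave _ _ (shift (fun m => 'C(n, m)%:R * w m))).
    by case=> [|m] //=; rewrite dseqE.
  apply/log_concave_shift/log_concaveM => //.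
  exact/log_concave_nat/bin_log_concave_down.
apply: (@eq_log_concave _ _ (shift (fun n => 'C(n, m)%:R * w m))).
  by case=> [|n] //=; rewrite dseqE.
apply/log_concave_shift/log_concaveM; last by apply: log_concave_cst; case: lw.
by apply: log_concave_nat => n; apply: bin_log_concave_up.
Qed.

Theorem proposition1 (R : realType) :
  (horizontally_log_concave (dseq (arith_one R) (arith_one R)) /\
   vertically_log_concave (dseq (arith_one R) (arith_one R))) /\
  (horizontally_log_concave (dseq (arith_id R) (arith_id R)) /\
   vertically_log_concave (dseq (arith_id R) (arith_id R))).
Proof.
split.
  apply: (@log_concave_dseq _ _ _ (fun=> 1)); last exact: log_concave_cst.
  by move=> n m; rewrite coefP_one mulr1.
exact: log_concave_dseq (@coefP_id R) (log_concave_inv_factS R).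
Qed.
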